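(* Let $\Bbbk$ be a commutative ring. The subspace $I$ of $B^{-1}_{\infty,2}$ spanned by the differences $t-s$ with $t,s\in\mathcal T_{\infty,2}$ and $t\sim s$ is a Baxter ideal (a two-sided ideal with $\beta_{\infty,2}(I)\subseteq I$), and $$M_\infty\cong B^{-1}_{\infty,2}/I$$ (as Baxter algebras).
   Context: All algebras are associative $\Bbbk$-algebras, not necessarily unital. A Baxter algebra of weight $\lambda$ is a pair $(A,\beta)$ with $A$ an algebra and $\beta:A\to A$ linear with $\beta(a)\beta(b)=\beta(\beta(a)b+a\beta(b)+\lambda ab)$. \textbf{The algebra $M_\infty$.} $M_\infty=\Bbbk\langle x_0,x_1\rangle$ is the free non-unital associative algebra on $x_0,x_1$, with operator $\beta_\infty:M_\infty\to M_\infty$ the algebra morphism with $\beta_\infty(x_0)=\beta_\infty(x_1)=x_1$; $(M_\infty,\beta_\infty)$ is a Baxter algebra of weight $-1$. \textbf{Decorated trees.} In a rooted planar tree, a node is a leaf if it has no children and internal otherwise; an angle is the sector between two consecutive children of an internal node. $\mathcal T_{\infty,2}$ is the set of finite rooted planar trees with at least one internal node, with each angle labeled by a positive integer and each internal node labeled by $0$ or $1$, such that: every internal node has at least two children; among the children of each node only the leftmost and rightmost can be leaves; only the root may have label $0$. $\mathcal T^+_{\infty,2}$ (resp. $\mathcal T^0_{\infty,2}$) is the subset of trees with root label $1$ (resp. $0$). $\bullet$ is the unlabeled tree with a single node; $\widehat{\mathcal T}_{\infty,2}=\mathcal T_{\infty,2}\cup\{\bullet\}$, $\widehat{\mathcal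 T}^+_{\infty,2}=\mathcal T^+_{\infty,2}\cup\{\bullet\}$. $\deg_{\mathrm{angle}}(t)$ is the sum of the angle labels of $t$, and $\deg_{\mathrm{angle}}(\bullet)=0$. \textbf{The relation $\sim$.} For $t,s\in\mathcal T_{\infty,2}$, $t\sim s$ means: (a) $t$ and $s$ have the same root label; (b) if the root label is $1$, then $\deg_{\mathrm{angle}}(t)=\deg_{\mathrm{angle}}(s)$; if the root label is $0$, then $t$ and $s$ have the same number $n$ of children of the root, $\deg_{\mathrm{angle}}(t_k)=\deg_{\mathrm{angle}}(s_k)$ for $k=1,\dots,n$, and $i_k=j_k$ for $k=1,\dots,n-1$, where $t_1,\dots,t_n$ are the subtrees of $t$ at the children of the root (left to right), $i_1,\dots,i_{n-1}$ the labels of the angles between these children, and $s_k$, $j_k$ are defined likewise for $s$. \textbf{The Baxter algebra $B^{-1}_{\infty,2}$ (weight $\lambda=-1$).} Grafting $G:\bigcup_{n\ge1}(\widehat{\mathcal T}^+_{\infty,2})^n\times(\mathbb Z^+)^{n-1}\to\widehat{\mathcal T}_{\infty,2}$: $G(t)=t$ for $n=1$; for $n\ge2$, $G(t_1,\dots,t_n;i_1,\dots,i_{n-1})$ attaches $t_1,\dots,t_n$ as the subtrees at the children of a new root labeled $0$, with label $i_k$ in the angle between the $k$-th and $(k+1)$-th children, and then for each $1<k<n$ with $t_k=\bullet$ removes that leaf and its edge and merges the two adjacent angles into one labeled by the sum of their labels. De-grafting: for $t\in\mathcal T^0_{\infty,2}$, $H(t)=(t_1,\dots,t_n;i_1,\dots,i_{n-1})$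 lists the subtrees at the children of the root and the labels of the angles between them; for $t\in\mathcal T^+_{\infty,2}$, $H(t)=t$ ($n=1$). $B_{\infty,2}$ and $\widehat B_{\infty,2}$ are the free $\Bbbk$-modules on $\mathcal T_{\infty,2}$ and $\widehat{\mathcal T}_{\infty,2}$, and all maps are extended (multi)linearly. $\beta_{\infty,2}(t)$ is $t$ with root label changed to $1$ (for $t\in\mathcal T_{\infty,2}$ with either root label), and $\beta_{\infty,2}(\bullet)=\bullet$. For $t\in\mathcal T^+_{\infty,2}$, $\overline t$ is $t$ with root label changed to $0$; $\overline\bullet=\bullet$. Products $\ast$ on $\widehat B_{\infty,2}$ and $\diamond$ on $B_{\infty,2}$ are defined by mutual recursion: $\bullet\ast u=u\ast\bullet=u$; for $t,s\in\mathcal T_{\infty,2}$ with $H(t)=(t_1,\dots,t_n;i_1,\dots,i_{n-1})$, $H(s)=(s_1,\dots,s_m;j_1,\dots,j_{m-1})$, $$t\diamond s=G\bigl(t_1,\dots,t_{n-1},\beta_{\infty,2}(\overline t_n\ast\overline s_1),s_2,\dots,s_m;i_1,\dots,i_{n-1},j_1,\dots,j_{m-1}\bigr);$$ and for $u,v\in\mathcal T_{\infty,2}$, $u\ast v=\beta_{\infty,2}(u)\diamond v+u\diamond\beta_{\infty,2}(v)-u\diamond v$. $B^{-1}_{\infty,2}$ is $B_{\infty,2}$ with product $\diamond$; $(B^{-1}_{\infty,2},\beta_{\infty,2})$ is a Baxter algebra of weight $-1$. *)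

(* Defs.v *)
From HB Require Import structures.
From mathcomp Require Import all_boot all_algebra.
From mathcomp Require Import finmap.
From mathcomp.classical Require Import boolp.
From mathcomp.multinomials Require Import xfinmap monalg.
Set Implicit Arguments.
Unset Strict Implicit.
Unset Printing Implicit Defensive.
Import GRing.Theory.
Local Open Scope ring_scope.

(* {malg R[K]} is an R-module only when R is a nonzero ring; the alias below
   makes it one over an arbitrary commutative ring. *)
Definition freemod (k : comPzRingType) (K : choiceType) : Type := {malg k[K]}.

Section FreeModule.
Context (k : comPzRingType) (K : choiceType).
Implicit Types (c : k) (g : freemod k K).

HB.instance Definition _ := GRing.Zmodule.copy (freemod k K) {malg k[K]}.

Definition fm_scale c g : freemod k K :=
  \sum_(x <- msupp g) << c * g@_x *g x >>.

Lemma fm_scaleE c g x : (fm_scale c g)@_x = c * g@_x.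
Proof.
rewrite {2}[g]monalgE /fm_scale !raddf_sum mulr_sumr.
by apply/eq_bigr=> /= i _; rewrite !mcoeffU mulrnAr.
Qed.

Lemma fm_scaleA c1 c2 g : fm_scale c1 (fm_scale c2 g) = fm_scale (c1 * c2) g.
Proof. by apply/malgP=> x; rewrite !fm_scaleE mulrA. Qed.

Lemma fm_scale1r : left_id 1 fm_scale.
Proof. by move=> g; apply/malgP=> x; rewrite !fm_scaleE mul1r. Qed.

Lemma fm_scaleDr : right_distributive fm_scale +%R.
Proof.
by move=> c g1 g2; apply/malgP=> x; rewrite fm_scaleE !mcoeffD !fm_scaleE mulrDr.
Qed.

Lemma fm_scaleDl g : {morph fm_scale^~ g : c1 c2 / c1 + c2}.
Proof.
by move=> c1 c2; apply/malgP=> x; rewrite fm_scaleE !mcoeffD !fm_scaleE mulrDl.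
Qed.

HB.instance Definition _ := GRing.Zmodule_isLmodule.Build k (freemod k K)
  fm_scaleA fm_scale1r fm_scaleDr fm_scaleDl.

Definition basis (x : K) : freemod k K := << 1 *g x >>.

Lemma mcoeffZ_free c g x : (c *: g)@_x = c * g@_x.
Proof. exact: fm_scaleE. Qed.

Lemma freemodE g : g = \sum_(x <- msupp g) g@_x *: basis x.
Proof.
rewrite [LHS]monalgE; apply: eq_bigr => x _.
by apply/malgP => y; rewrite mcoeffZ_free !mcoeffU mulrnAr mulr1.
Qed.

End FreeModule.

(* The linear extension of f : K -> V. *)
HB.lock Definition lin_ext (k : comPzRingType) (K : choiceType)
    (V : lmodType k) (f : K -> V) (g : freemod k K) : V :=
  \sum_(x <- msupp g) g@_x *: f x.
Canonical lin_ext_unlockable := Unlockable lin_ext.unlock.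

Section FreeModuleTheory.
Context (k : comPzRingType) (K : choiceType).
Implicit Types (c : k) (g : freemod k K).

Section LinExt.
Context (V : lmodType k) (f : K -> V).

Lemma lin_extEw (d : {fset K}) g : (msupp g `<=` d)%fset ->
  lin_ext f g = \sum_(x <- d) g@_x *: f x.
Proof.
move=> le; rewrite unlock (big_fset_incl _ le) => //= x xd /mcoeff_outdom ->.
by rewrite scale0r.
Qed.

Lemma lin_ext_is_linear : linear (lin_ext f).
Proof.
move=> c g1 g2.
pose d := (msupp (c *: g1 + g2) `|` (msupp g1 `|` msupp g2))%fset.
rewrite (@lin_extEw d (_ + _)) ?fsubsetUl // (@lin_extEw d g1); last first.
  by rewrite /d fsetUA fsubsetU // fsubsetUr.
rewrite (@lin_extEw d g2); last by rewrite /d fsetUA fsubsetUr.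
rewrite scaler_sumr -big_split /=; apply: eq_bigr => x _.
by rewrite mcoeffD mcoeffZ_free scalerDl scalerA.
Qed.

HB.instance Definition _ :=
  GRing.isLinear.Build k (freemod k K) V *:%R (lin_ext f) lin_ext_is_linear.

Lemma lin_ext_basis x : lin_ext f (basis k x) = f x.
Proof.
by rewrite (@lin_extEw [fset x]%fset) ?msuppU_le // big_seq_fset1 mcoeffUU scale1r.
Qed.
End LinExt.

Lemma linear_basis_ext (V : lmodType k) (f1 f2 : freemod k K -> V) :
  linear f1 -> linear f2 -> (forall x, f1 (basis k x) = f2 (basis k x)) ->
  f1 =1 f2.
Proof.
move=> l1 l2 e g; rewrite [g]freemodE.
pose F1 := GRing.isLinear.Build k _ V *:%R f1 l1.
pose F2 := GRing.isLinear.Build k _ V *:%R f2 l2.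
pose G1 : {linear freemod k K -> V} := HB.pack f1 F1.
pose G2 : {linear freemod k K -> V} := HB.pack f2 F2.
rewrite -[f1]/(G1 : _ -> _) -[f2]/(G2 : _ -> _) !linear_sum.
by apply: eq_bigr => x _; rewrite !linearZ /= e.
Qed.
End FreeModuleTheory.

Section Bilinear.
Context (k : comPzRingType) (K L : choiceType) (V : lmodType k).

Definition bilin_ext (f : K -> L -> V) (g : freemod k K) (h : freemod k L) : V :=
  lin_ext (fun x => lin_ext (f x) h) g.

Lemma bilin_ext_linl f h : linear (bilin_ext f ^~ h).
Proof. by move=> c g1 g2; rewrite /bilin_ext linearP. Qed.

Lemma bilin_ext_linr f g : linear (bilin_ext f g).
Proof.
move=> c h1 h2; rewrite /bilin_ext !(lin_extEw _ (fsubset_refl (msupp g))).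
rewrite scaler_sumr -big_split /=; apply: eq_bigr => x _.
by rewrite linearP scalerDr !scalerA mulrC.
Qed.

Lemma bilin_ext_basis f x y : bilin_ext f (basis k x) (basis k y) = f x y.
Proof. by rewrite /bilin_ext !lin_ext_basis. Qed.
End Bilinear.

HB.mixin Record isBaxterAlgebra (k : comPzRingType) (lam : k) A
    of GRing.Lmodule k A := {
  bmul : A -> A -> A;
  bop : A -> A;
  bmul_linl : forall b, linear (bmul^~ b);
  bmul_linr : forall a, linear (bmul a);
  bmulA : associative bmul;
  bop_lin : linear bop;
  bop_baxter : forall a b, bmul (bop a) (bop b) =
    bop (bmul (bop a) b + bmul a (bop b) + lam *: bmul a b)
}.

#[short(type="baxterAlgType")]
HB.structure Definition BaxterAlgebra (k : comPzRingType) (lam : k) :=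
  {A of GRing.Lmodule k A & isBaxterAlgebra k lam A}.

Definition baxter_isomorphic (k : comPzRingType) (lam : k)
    (A B : baxterAlgType lam) : Prop :=
  exists f : {linear A -> B},
    [/\ bijective f, {morph f : x y / bmul x y} & {morph f : x / bop x}].

Record baxter_ideal (k : comPzRingType) (lam : k) (A : baxterAlgType lam)
    (I : A -> Prop) : Prop := BaxterIdeal {
  bideal0 : I 0;
  bidealP : forall c x y, I x -> I y -> I (c *: x + y);
  bidealMl : forall a x, I x -> I (bmul a x);
  bidealMr : forall a x, I x -> I (bmul x a);
  bideal_bop : forall x, I x -> I (bop x)
}.


Section BaxterTheory.
Context (k : comPzRingType) (lam : k) (A : baxterAlgType lam).
Implicit Types x y z : A.

Lemma bmulBl x y z : bmul (x - y) z = bmul x z - bmul y z.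
Proof. by rewrite -scaleN1r addrC bmul_linl scaleN1r addrC. Qed.

Lemma bmulBr x y z : bmul z (x - y) = bmul z x - bmul z y.
Proof. by rewrite -scaleN1r addrC bmul_linr scaleN1r addrC. Qed.

Lemma bopB x y : bop (x - y) = bop x - bop y.
Proof. by rewrite -scaleN1r addrC bop_lin scaleN1r addrC. Qed.

End BaxterTheory.

Section Quotient.
Local Open Scope quotient_scope.
Context (k : comPzRingType) (lam : k) (A : baxterAlgType lam) (I : A -> Prop).
Implicit Type hI : baxter_ideal I.

Definition ideal_pred hI : {pred A} := fun x => `[< I x >].

Lemma ideal_predE hI x : (x \in ideal_pred hI) = `[< I x >].
Proof. by []. Qed.

Lemma ideal_pred_zmod hI : zmod_closed (ideal_pred hI).
Proof.
split=> [|x y]; first exact/asboolP/(bideal0 hI).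
rewrite !ideal_predE => /asboolP Ix /asboolP Iy; apply/asboolP.
by rewrite addrC -scaleN1r; apply: (bidealP hI).
Qed.

HB.instance Definition _ hI :=
  GRing.isZmodClosed.Build A (ideal_pred hI) (ideal_pred_zmod hI).

Definition baxter_quot hI := Quotient.quot (ideal_pred hI).

Section Ops.
Context (hI : baxter_ideal I).
Local Notation Q := (baxter_quot hI).

HB.instance Definition _ := GRing.Zmodule.on Q.

Definition bproj (x : A) : Q := \pi_(Quotient.quot (ideal_pred hI)) x.
Definition brepr (q : Q) : A := repr (q : Quotient.quot (ideal_pred hI)).

Lemma breprK : cancel brepr bproj.
Proof. exact: reprK. Qed.

Lemma bproj_eq x y : bproj x = bproj y <-> I (x - y).
Proof.
rewrite /bproj; split=> [/eqP|h]; last apply/eqP.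
  by rewrite -Quotient.idealrBE => /asboolP.
by rewrite -Quotient.idealrBE; apply/asboolP.
Qed.

Lemma brepr_proj x : I (brepr (bproj x) - x).
Proof. by apply/bproj_eq; rewrite breprK. Qed.

Lemma bprojB : {morph bproj : x y / x - y}.
Proof. by move=> x y; rewrite /bproj raddfB. Qed.

Lemma bprojD : {morph bproj : x y / x + y}.
Proof. by move=> x y; rewrite /bproj raddfD. Qed.

Lemma bideal_scale c x : I x -> I (c *: x).
Proof. by move=> h; rewrite -[_ *: _]addr0; apply: bidealP (bideal0 hI). Qed.

Lemma bideal_add x y : I x -> I y -> I (x + y).
Proof. by move=> hx hy; rewrite -[x]scale1r; apply: (bidealP hI). Qed.

Definition bq_scale c (q : Q) : Q := bproj (c *: brepr q).
Definition bq_mul (p q : Q) : Q := bproj (bmul (brepr p) (brepr q)).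
Definition bq_op (q : Q) : Q := bproj (bop (brepr q)).

Lemma bproj_scale c x : bq_scale c (bproj x) = bproj (c *: x).
Proof.
by apply/bproj_eq; rewrite -scalerBr; apply/bideal_scale/brepr_proj.
Qed.

Lemma bproj_mul x y : bq_mul (bproj x) (bproj y) = bproj (bmul x y).
Proof.
apply/bproj_eq; rewrite -[X in X - _](subrK (bmul x (brepr (bproj y)))).
rewrite -bmulBl -addrA -bmulBr; apply: bideal_add.
  exact/(bidealMr hI)/brepr_proj.
exact/(bidealMl hI)/brepr_proj.
Qed.

Lemma bproj_op x : bq_op (bproj x) = bproj (bop x).
Proof. by apply/bproj_eq; rewrite -bopB; apply/(bideal_bop hI)/brepr_proj. Qed.

Lemma bq_scaleA c1 c2 q : bq_scale c1 (bq_scale c2 q) = bq_scale (c1 * c2) q.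
Proof. by rewrite -[q]breprK !bproj_scale scalerA. Qed.

Lemma bq_scale1r : left_id 1 bq_scale.
Proof. by move=> q; rewrite -[q]breprK bproj_scale scale1r. Qed.

Lemma bq_scaleDr : right_distributive bq_scale +%R.
Proof.
move=> c p q; rewrite -[p]breprK -[q]breprK -bprojD !bproj_scale scalerDr.
exact: bprojD.
Qed.

Lemma bq_scaleDl q : {morph bq_scale^~ q : c1 c2 / c1 + c2}.
Proof.
by move=> c1 c2; rewrite -[q]breprK !bproj_scale scalerDl; exact: bprojD.
Qed.

HB.instance Definition _ := GRing.Zmodule_isLmodule.Build k Q
  bq_scaleA bq_scale1r bq_scaleDr bq_scaleDl.

Lemma bproj_is_linear : linear bproj.
Proof. by move=> c x y; rewrite bprojD -bproj_scale. Qed.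

Lemma bq_mul_linl q : linear (bq_mul^~ q).
Proof.
move=> c p1 p2; rewrite -[q]breprK -[p1]breprK -[p2]breprK.
by rewrite -bproj_is_linear !bproj_mul bmul_linl bproj_is_linear.
Qed.

Lemma bq_mul_linr p : linear (bq_mul p).
Proof.
move=> c q1 q2; rewrite -[p]breprK -[q1]breprK -[q2]breprK.
by rewrite -bproj_is_linear !bproj_mul bmul_linr bproj_is_linear.
Qed.

Lemma bq_mulA : associative bq_mul.
Proof.
move=> p q r; rewrite -[p]breprK -[q]breprK -[r]breprK.
by rewrite !bproj_mul bmulA.
Qed.

Lemma bq_op_lin : linear bq_op.
Proof.
move=> c q1 q2; rewrite -[q1]breprK -[q2]breprK.
by rewrite -bproj_is_linear !bproj_op bop_lin bproj_is_linear.
Qed.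

Lemma bq_op_baxter p q : bq_mul (bq_op p) (bq_op q) =
  bq_op (bq_mul (bq_op p) q + bq_mul p (bq_op q) + lam *: bq_mul p q).
Proof.
rewrite -[p]breprK -[q]breprK !(bproj_op, bproj_mul).
rewrite -[lam *: _]/(bq_scale _ _) bproj_scale -!bprojD bproj_op.
by rewrite bop_baxter.
Qed.

HB.instance Definition _ := isBaxterAlgebra.Build k lam Q
  bq_mul_linl bq_mul_linr bq_mulA bq_op_lin bq_op_baxter.
End Ops.
End Quotient.

(* The free non-unital algebra on x_0, x_1: the free module on the nonempty
   words in the letters false (for x_0) and true (for x_1), the product being
   concatenation. *)
Definition word : Type := {w : seq bool | w != [::]}.
HB.instance Definition _ := SubChoice.on word.

Definition letter (b : bool) : word := exist (fun w => w != [::]) [:: b] isT.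

Lemma word_cat_subproof (u v : word) : val u ++ val v != [::].
Proof. by case: u => [[|a u] //]. Qed.

Definition word_cat (u v : word) : word := exist (fun w => w != [::]) _ (word_cat_subproof u v).

Lemma word_beta_subproof (w : word) : [seq true | _ <- val w] != [::].
Proof. by case: w => [[|a u] //]. Qed.

Definition word_beta (w : word) : word := exist (fun w => w != [::]) _ (word_beta_subproof w).

Lemma word_catA : associative word_cat.
Proof. by move=> u v w; apply/val_inj; rewrite /= catA. Qed.

Lemma word_betaM : {morph word_beta : u v / word_cat u v}.
Proof. by move=> u v; apply/val_inj; rewrite /= map_cat. Qed.

Definition Minf (k : comPzRingType) : Type := freemod k word.

Section Minf.
Context (k : comPzRingType).
HB.instance Definition _ := GRing.Lmodule.on (Minf k).

Definition Minf_mul : Minf k -> Minf k -> Minf k :=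
  bilin_ext (fun u v => basis k (word_cat u v)).
Definition Minf_beta : Minf k -> Minf k :=
  lin_ext (fun w => basis k (word_beta w)).

Lemma Minf_mulE u v :
  Minf_mul (basis k u) (basis k v) = basis k (word_cat u v).
Proof. exact: bilin_ext_basis. Qed.

Lemma Minf_betaE w : Minf_beta (basis k w) = basis k (word_beta w).
Proof. exact: lin_ext_basis. Qed.

Lemma Minf_mul_linl v : linear (Minf_mul^~ v).
Proof. exact: bilin_ext_linl. Qed.

Lemma Minf_mul_linr u : linear (Minf_mul u).
Proof. exact: bilin_ext_linr. Qed.

Lemma Minf_beta_lin : linear Minf_beta.
Proof. exact: lin_ext_is_linear. Qed.

Lemma Minf_mulA : associative Minf_mul.
Proof.
move=> u v w; move: u.
apply: linear_basis_ext => [c x y|c x y|u]; rewrite ?Minf_mul_linl //.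
move: v; apply: linear_basis_ext => [c x y|c x y|v].
- by rewrite Minf_mul_linl Minf_mul_linr.
- by rewrite Minf_mul_linr Minf_mul_linl.
move: w; apply: linear_basis_ext => [c x y|c x y|w].
- by rewrite !Minf_mul_linr.
- by rewrite Minf_mul_linr.
by rewrite !Minf_mulE word_catA.
Qed.

Lemma Minf_betaM : {morph Minf_beta : u v / Minf_mul u v}.
Proof.
move=> u v; move: u; apply: linear_basis_ext => [c x y|c x y|u].
- by rewrite Minf_mul_linl Minf_beta_lin.
- by rewrite Minf_beta_lin Minf_mul_linl.
move: v; apply: linear_basis_ext => [c x y|c x y|v].
- by rewrite Minf_mul_linr Minf_beta_lin.
- by rewrite Minf_beta_lin Minf_mul_linr.
by rewrite Minf_mulE !Minf_betaE Minf_mulE word_betaM.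
Qed.

(* Minf_betaM and this lemma characterize the operator: it is the algebra
   morphism sending both generators to x_1. *)
Lemma Minf_beta_letter b :
  Minf_beta (basis k (letter b)) = basis k (letter true).
Proof. by rewrite Minf_betaE; congr basis; apply/val_inj. Qed.

Lemma Minf_betaK u : Minf_beta (Minf_beta u) = Minf_beta u.
Proof.
move: u; apply: linear_basis_ext => [c x y|c x y|u]; rewrite ?Minf_beta_lin //.
by rewrite !Minf_betaE; congr basis; apply/val_inj; rewrite /= -map_comp.
Qed.

Lemma Minf_beta_baxter u v : Minf_mul (Minf_beta u) (Minf_beta v) =
  Minf_beta (Minf_mul (Minf_beta u) v + Minf_mul u (Minf_beta v)
    + -1 *: Minf_mul u v).
Proof.
rewrite addrC Minf_beta_lin scaleN1r -[Minf_mul (Minf_beta u) v]scale1r.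
by rewrite Minf_beta_lin scale1r !Minf_betaM !Minf_betaK addKr.
Qed.

HB.instance Definition _ := isBaxterAlgebra.Build k (-1) (Minf k)
  Minf_mul_linl Minf_mul_linr Minf_mulA Minf_beta_lin Minf_beta_baxter.
End Minf.

Definition angle : Type := {i : nat | (0 < i)%N}.
HB.instance Definition _ := SubChoice.on angle.

Lemma angle_add_subproof (i j : angle) : (0 < val i + val j)%N.
Proof. by rewrite addn_gt0 (valP i). Qed.

Definition angle_add (i j : angle) : angle :=
  exist (fun n => (0 < n)%N) _ (angle_add_subproof i j).

(* An internal node carrying its whole subtree:
     INode c_1 [:: (i_1, c_2); ...; (i_(n-2), c_(n-1))] i_(n-1) c_n
   has the n >= 2 children c_1, ..., c_n separated by angles labeled
   i_1, ..., i_(n-1); only the extreme children c_1 and c_n can be leaves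
   (None). Every non-root internal node is labeled 1, so that labels are not
   recorded here; the root label is added in dtree. *)
Inductive inode : Type :=
  INode of option inode & seq (angle * inode) & angle & option inode.

HB.instance Definition _ := gen_eqMixin inode.
HB.instance Definition _ := gen_choiceMixin inode.

(* The trees whose root, if internal, is labeled 1, plus the one-node tree
   None: these are the subtrees at the children of a node. *)
Definition ctree : Type := option inode.
HB.instance Definition _ := Choice.on ctree.

(* The decorated trees with an internal node, with their root label
   (true for 1, false for 0). *)
Definition dtree : Type := (bool * inode)%type.
HB.instance Definition _ := Choice.on dtree.

(* The decorated trees together with the one-node tree None. *)
Definition htree : Type := option dtree.
HB.instance Definition _ := Choice.on htree.

Fixpoint angle_deg_inode (f : inode) : nat :=
  let: INode a m i l := f in
  (if a is Some g then angle_deg_inode g else 0)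
  + sumn [seq (val p.1 + angle_deg_inode p.2)%N | p <- m]
  + val i + (if l is Some g then angle_deg_inode g else 0).

Definition angle_deg_ctree (x : ctree) : nat :=
  if x is Some f then angle_deg_inode f else 0%N.

Definition angle_deg (t : dtree) : nat := angle_deg_inode t.2.

(* The root label replaced by b. *)
Definition relabel (b : bool) (t : dtree) : dtree := (b, t.2).

Definition ctree_bar (x : ctree) : htree := omap (pair false) x.
Definition htree_beta (y : htree) : ctree := omap snd y.

(* Grafting attaches the children from left to right. A state of the
   construction is either None (no child attached yet), or
   Some (c_1, [:: (i_1, c_2); ...; (i_(n-1), c_n)], i_n): the children c_1, ...,
   c_n are attached and the angle i_n after c_n is open. Attaching a leaf that
   is neither the first nor the last child (one that is followed by another
   angle) just adds the label of that angle to the open one. *)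
Definition pnode : Type := option (ctree * seq (angle * inode) * angle).

Definition pnode_push (p : pnode) (x : ctree * angle) : pnode :=
  match p, x with
  | None, (c, j) => Some (c, [::], j)
  | Some (a, m, i), (None, j) => Some (a, m, angle_add i j)
  | Some (a, m, i), (Some f, j) => Some (a, rcons m (i, f), j)
  end.

Definition pnode_close (p : pnode) (l : ctree) : htree :=
  match p with
  | None => omap (pair true) l
  | Some (a, m, i) => Some (false, INode a m i l)
  end.

(* The grafting G of (t_1, ..., t_n; i_1, ..., i_(n-1)); zip drops t_n. *)
Definition graft (ts : seq ctree) (ia : seq angle) : htree :=
  pnode_close (foldl pnode_push None (zip ts ia)) (last None ts).

Definition degraft (t : dtree) : seq ctree * seq angle :=
  match t with
  | (true, f) => ([:: Some f], [::])
  | (false, INode a m i l) =>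
      (a :: rcons [seq Some p.2 | p <- m] l, rcons [seq p.1 | p <- m] i)
  end.

Definition tree_sim (t s : dtree) : Prop :=
  t.1 = s.1 /\
  if t.1 then angle_deg t = angle_deg s
  else let: (ts, ia) := degraft t in
       let: (ss, ja) := degraft s in
       [/\ size ts = size ss,
           map angle_deg_ctree ts = map angle_deg_ctree ss
         & ia = ja].

Section TreeProducts.
Context (k : comPzRingType).

(* t <> s, from the values st of the product * on pairs of trees: with
   (t_1, ..., t_n; i_1, ..., i_(n-1)) and (s_1, ..., s_m; j_1, ..., j_(m-1))
   the de-graftings of t and s, the junction t_n, s_1 is replaced by
   beta (\bar t_n * \bar s_1). *)
Definition diamond_with (st : htree -> htree -> freemod k htree)
    (t s : dtree) : freemod k htree :=
  let: (ts, ia) := degraft t in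
  let: (ss, ja) := degraft s in
  lin_ext (fun x : ctree =>
      basis k (graft (take (size ts).-1 ts ++ x :: behead ss) (ia ++ ja)))
    (lin_ext (fun y => basis k (htree_beta y))
      (st (ctree_bar (last None ts)) (ctree_bar (head None ss)))).

Fixpoint star_rec (n : nat) (u v : htree) : freemod k htree :=
  if n is n'.+1 then
    match u, v with
    | None, _ => basis k v
    | _, None => basis k u
    | Some t, Some s =>
        diamond_with (star_rec n') (relabel true t) s
        + diamond_with (star_rec n') t (relabel true s)
        - diamond_with (star_rec n') t s
    end
  else 0.

Fixpoint rdepth (f : inode) : nat :=
  let: INode _ _ _ l := f in (if l is Some g then rdepth g else 0).+1.
Fixpoint ldepth (f : inode) : nat :=
  let: INode a _ _ _ := f in (if a is Some g then ldepth g else 0).+1.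
Definition hrdepth (u : htree) : nat :=
  if u is Some (b, f) then (b + rdepth f)%N else 0%N.
Definition hldepth (u : htree) : nat :=
  if u is Some (b, f) then (b + ldepth f)%N else 0%N.

(* The fuel always suffices: star and diamond satisfy the expected mutual
   recursion, see star_None, star_Nonel, star_Some below. *)
Definition star (u v : htree) : freemod k htree :=
  star_rec (hrdepth u + hldepth v).+1 u v.

Definition diamond (t s : dtree) : freemod k htree := diamond_with star t s.

(* For computing with the products: tree_lc t is t with its last child removed
   (None if t has root label 1, as then t itself is the last entry of its
   de-grafting), and finish p x s attaches to p the tree x and all entries of
   the de-grafting of s but the first. *)
Definition tree_lc (t : dtree) : pnode :=
  if t is (false, INode a m i _) then Some (a, m, i) else None.
Definition tree_last (t : dtree) : ctree :=
  if t is (false, INode _ _ _ l) then l else Some t.2.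
Definition tree_first (t : dtree) : ctree :=
  if t is (false, INode a _ _ _) then a else Some t.2.
Definition expand (x : ctree) (m : seq (angle * inode)) (i : angle) :=
  zip (x :: [seq Some p.2 | p <- m]) (rcons [seq p.1 | p <- m] i).
Definition finish (p : pnode) (x : ctree) (s : dtree) : htree :=
  if s is (false, INode _ m i l)
  then pnode_close (foldl pnode_push p (expand x m i)) l
  else pnode_close p x.

Lemma expand_rcons x m p i : expand x (rcons m p) i =
  rcons (expand x m p.1) (Some p.2, i).
Proof.
rewrite /expand !map_rcons -rcons_cons zip_rcons //.
by rewrite /= size_rcons !size_map.
Qed.

Lemma push_expand a m i : foldl pnode_push None (expand a m i) = Some (a, m, i).
Proof.
elim/last_ind: m i => [//|m p IH] i.
by rewrite expand_rcons foldl_rcons IH /=; case: p.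
Qed.

Lemma push_neq0 p x m i : exists q, foldl pnode_push p (expand x m i) = Some q.
Proof.
elim/last_ind: m i => [|m r IH] i.
  case: p => [[[a n] j]|]; last by eexists.
  by case: x => [f|]; eexists.
rewrite expand_rcons foldl_rcons; have [[[a n] j] ->] := IH r.1.
by eexists.
Qed.

Lemma graftE t s x : let: (ts, ia) := degraft t in let: (ss, ja) := degraft s in
  graft (take (size ts).-1 ts ++ x :: behead ss) (ia ++ ja) =
  finish (tree_lc t) x s.
Proof.
have zE (y : ctree) m i (l : ctree) : zip (y :: rcons [seq Some p.2 | p <- m] l)
    (rcons [seq p.1 | p <- m] i) = expand y m i.
  rewrite /expand -rcons_cons -[rcons (_ :: _) l]cats1.
  by rewrite -[X in zip _ X]cats0 zip_cat ?cats0 // size_rcons /= !size_map.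
case: t => -[f|[a m i l]].
  by case: s => -[g|[b n j r]] //=; rewrite /graft /= zE last_rcons.
rewrite [degraft (false, INode a m i l)]/degraft.
have -> : take (size (a :: rcons [seq Some p.2 | p <- m] l)).-1
    (a :: rcons [seq Some p.2 | p <- m] l) = a :: [seq Some p.2 | p <- m].
  by rewrite /= size_rcons /= -cats1 take_size_cat.
have sE : size (a :: [seq Some p.2 | p <- m]) = size (rcons [seq p.1 | p <- m] i).
  by rewrite size_rcons /= !size_map.
case: s => -[g|[b n j r]] /=; rewrite /graft.
  by rewrite -cat_cons zip_cat // foldl_cat [X in foldl _ X _]push_expand last_cat.
rewrite -cat_cons zip_cat // foldl_cat [X in foldl _ X _]push_expand last_cat /=.
by rewrite zE last_rcons.
Qed.

Lemma diamond_withE st t s : diamond_with st t s =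
  lin_ext (fun x => basis k (finish (tree_lc t) x s))
    (lin_ext (fun y => basis k (htree_beta y))
      (st (ctree_bar (tree_last t)) (ctree_bar (tree_first s)))).
Proof.
have lE : last None (degraft t).1 = tree_last t.
  by case: t => -[f|[a m i l]] //=; rewrite last_rcons.
have hE : head None (degraft s).1 = tree_first s.
  by case: s => -[f|[a m i l]].
have gE x := graftE t s x.
rewrite /diamond_with; case: (degraft t) (degraft s) lE hE gE.
move=> ts ia [ss ja] /= -> -> gE.
by congr (lin_ext _ _); apply/funext => x; rewrite gE.
Qed.

Lemma tree_last_depth b f :
  (hrdepth (ctree_bar (tree_last (b, f))) <= rdepth f)%N /\
  (hrdepth (ctree_bar (tree_last (b, f))) < b + rdepth f)%N.
Proof. by case: b f => -[a m i [l|]]. Qed.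

Lemma tree_first_depth b f :
  (hldepth (ctree_bar (tree_first (b, f))) <= ldepth f)%N /\
  (hldepth (ctree_bar (tree_first (b, f))) < b + ldepth f)%N.
Proof. by case: b f => -[[a|] m i l]. Qed.

Lemma star_rec_stable n m u v :
  (hrdepth u + hldepth v < n)%N -> (hrdepth u + hldepth v < m)%N ->
  star_rec n u v = star_rec m u v.
Proof.
elim: n m u v => [//|n IH] [//|m] [[b f]|] [[c g]|]; [|by []..].
rewrite /= => hn hm.
have E b' c' : (b', c') \in [:: (true, c); (b, true); (b, c)] ->
    diamond_with (star_rec n) (b', f) (c', g) =
    diamond_with (star_rec m) (b', f) (c', g).
  rewrite !diamond_withE => h.
  suff hh : (hrdepth (ctree_bar (tree_last (b', f)))
      + hldepth (ctree_bar (tree_first (c', g))) < b + rdepth f + (c + ldepth g))%N.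
    by rewrite (IH m) // (leq_trans hh).
  have [l1 l2] := tree_last_depth b' f; have [r1 r2] := tree_first_depth c' g.
  move: h; rewrite !inE => /or3P[] /eqP[? ?]; subst b' c'.
  - rewrite -addnS leq_add //; apply: leq_trans l1 _; exact: leq_addl.
  - rewrite -addSn leq_add //; apply: leq_trans r1 _; exact: leq_addl.
  - by rewrite -addSn leq_add // ltnW.
by rewrite /relabel /= !E // !inE eqxx ?orbT.
Qed.

Lemma star_None v : star None v = basis k v.
Proof. by []. Qed.

Lemma star_Nonel u : star u None = basis k u.
Proof. by case: u. Qed.

Lemma star_Some t s : star (Some t) (Some s) =
  diamond (relabel true t) s + diamond t (relabel true s) - diamond t s.
Proof.
case: t s => [b f] [c g].
have [N NE] : exists N, N = (hrdepth (Some (b, f)) + hldepth (Some (c, g))).+2.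
  by eexists.
have E b' c' : diamond_with (star_rec N) (b', f) (c', g) = diamond (b', f) (c', g).
  rewrite /diamond diamond_withE diamond_withE /star.
  rewrite (@star_rec_stable N (hrdepth (ctree_bar (tree_last (b', f)))
    + hldepth (ctree_bar (tree_first (c', g)))).+1) //.
  have [l1 _] := tree_last_depth b' f; have [r1 _] := tree_first_depth c' g.
  rewrite NE ltnW // ltnS ltnS leq_add //=.
    by apply: leq_trans l1 _; apply: leq_addl.
  by apply: leq_trans r1 _; apply: leq_addl.
rewrite /star (@star_rec_stable _ N.+1); [|exact: ltnSn|by rewrite NE ltnW // ltnW].
by rewrite /relabel -!E.
Qed.

Lemma lin_ext_comp (K : choiceType) (V W : lmodType k) (f : K -> V)
    (phi : V -> W) g : linear phi -> phi (lin_ext f g) = lin_ext (phi \o f) g.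
Proof.
move=> phil; move: g; apply: linear_basis_ext => [c x y|c x y|x].
- by rewrite linearP phil.
- by rewrite linearP.
by rewrite !lin_ext_basis.
Qed.

Lemma lin_ext_lin (K L : choiceType) (V : lmodType k) (f : L -> V)
    (h : K -> freemod k L) g :
  lin_ext f (lin_ext h g) = lin_ext (fun x => lin_ext f (h x)) g.
Proof. exact: (@lin_ext_comp _ _ _ h (lin_ext f) g (lin_ext_is_linear f)). Qed.

Lemma lin_ext_swap (K L : choiceType) (V : lmodType k) (f : K -> L -> V) g h :
  lin_ext (fun x => lin_ext (f x) h) g = lin_ext (fun y => lin_ext (f^~ y) g) h.
Proof.
move: g; apply: linear_basis_ext => [c x y|c x y|x].
- by rewrite linearP.
- exact: (@bilin_ext_linr k L K V (fun y x => f x y) h).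
rewrite lin_ext_basis; congr (lin_ext _ h); apply/funext => y.
by rewrite lin_ext_basis.
Qed.

Lemma eq_lin_ext (K : choiceType) (V : lmodType k) (f1 f2 : K -> V) :
  f1 =1 f2 -> lin_ext f1 =1 lin_ext f2.
Proof. by move=> /funext ->. Qed.

(* The product with values in the span of the trees other than None; nothing
   is lost in this projection, see dtree_mulE. *)
Definition dtree_of_htree (y : htree) : freemod k dtree :=
  if y is Some t then basis k t else 0.

Definition dtree_mul (t s : dtree) : freemod k dtree :=
  lin_ext dtree_of_htree (diamond t s).

Definition tree_mul : freemod k dtree -> freemod k dtree -> freemod k dtree :=
  bilin_ext dtree_mul.

Definition tree_beta : freemod k dtree -> freemod k dtree :=
  lin_ext (fun t => basis k (relabel true t)).

Definition tree_un : freemod k dtree -> freemod k dtree :=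
  lin_ext (fun t => basis k (relabel false t)).

(* beta (\bar a * \bar b) *)
Definition jct (a b : ctree) : freemod k ctree :=
  lin_ext (fun y => basis k (htree_beta y)) (star (ctree_bar a) (ctree_bar b)).

Definition fins p x s := dtree_of_htree (finish p x s).

Definition below (t : dtree) : freemod k ctree := basis k (Some t.2).
Definition rooted b f : freemod k dtree := basis k (b, f).

(* \bar f * \bar g *)
Definition nstar f g :=
  tree_mul (rooted true f) (rooted false g)
  + tree_mul (rooted false f) (rooted true g)
  - tree_mul (rooted false f) (rooted false g).

Lemma tree_mulE t s : tree_mul (basis k t) (basis k s) =
  lin_ext (fun x => fins (tree_lc t) x s) (jct (tree_last t) (tree_first s)).
Proof.
rewrite /tree_mul bilin_ext_basis /dtree_mul /diamond diamond_withE.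
rewrite lin_ext_lin.
by apply: eq_lin_ext => x; rewrite /= lin_ext_basis.
Qed.

Lemma finish_some p x s : p <> None \/ s.1 = false ->
  exists2 f, finish p x s = Some (false, f) & True.
Proof.
case: s => -[g|[b n j r]] /= h; last first.
  by have [[[a m] i] ->] := push_neq0 p x n j; eexists.
by case: h => // h; case: p h => [[[a m] i] _|]; first by eexists.
Qed.

Lemma diamond_incl t s : tree_lc t <> None \/ s.1 = false ->
  diamond t s = lin_ext (fun r => basis k (Some r)) (tree_mul (basis k t) (basis k s)).
Proof.
move=> h; rewrite tree_mulE /tree_un lin_ext_lin.
rewrite /diamond diamond_withE; apply: eq_lin_ext => x /=.
by rewrite /fins; have [f -> _] := finish_some x h; rewrite lin_ext_basis.
Qed.

Lemma jctE f g : jct (Some f) (Some g) = lin_ext below (nstar f g).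
Proof.
have E b c : b && c = false ->
    lin_ext (fun y => basis k (htree_beta y)) (diamond (b, f) (c, g)) =
    lin_ext below (tree_mul (rooted b f) (rooted c g)).
  move=> h; rewrite diamond_incl; last first.
    by case: b c h => -[] //= _; [right|left; case: (f)|left; case: (f)].
  rewrite lin_ext_lin; apply: eq_lin_ext => t /=.
  by rewrite lin_ext_basis.
rewrite /jct star_Some /nstar !linearB !linearD /=.
by rewrite /relabel !E.
Qed.

Lemma jctN b : jct None b = basis k b.
Proof. by rewrite /jct lin_ext_basis; case: b. Qed.

Lemma jctN' a : jct a None = basis k a.
Proof. by rewrite /jct star_Nonel lin_ext_basis; case: a. Qed.

Lemma tree_mul_linl v : linear (tree_mul^~ v).
Proof. exact: bilin_ext_linl. Qed.

Lemma tree_mul_linr u : linear (tree_mul u).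
Proof. exact: bilin_ext_linr. Qed.

Lemma tree_beta_lin : linear tree_beta.
Proof. exact: lin_ext_is_linear. Qed.

Lemma tree_un_mul b c f g : b && c = false ->
  tree_un (tree_mul (rooted b f) (rooted c g)) = tree_mul (rooted b f) (rooted c g).
Proof.
move=> h; rewrite tree_mulE /tree_un lin_ext_lin.
apply: eq_lin_ext => x /=; rewrite /fins.
have [] := @finish_some (tree_lc (b, f)) x (c, g).
  by case: b c h => -[] //= _; [right|left; case: (f)|left; case: (f)].
by move=> r -> _; rewrite /= lin_ext_basis.
Qed.

HB.instance Definition _ := GRing.isLinear.Build k _ _ *:%R tree_un
  (lin_ext_is_linear _).
HB.instance Definition _ := GRing.isLinear.Build k _ _ *:%R tree_beta
  tree_beta_lin.

Lemma tree_un_S f g : tree_un (nstar f g) = nstar f g.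
Proof. by rewrite /nstar linearB linearD /= !tree_un_mul. Qed.

Lemma tree_beta_S f g : tree_beta (nstar f g) = tree_mul (rooted true f) (rooted true g).
Proof.
rewrite [RHS]tree_mulE jctE /tree_beta lin_ext_lin.
by apply: eq_lin_ext => t; rewrite /= lin_ext_basis.
Qed.

Lemma dtree_mulE t s :
  diamond t s = lin_ext (fun r => basis k (Some r)) (dtree_mul t s).
Proof.
rewrite /dtree_mul -[lin_ext dtree_of_htree _](bilin_ext_basis dtree_mul).
rewrite -/tree_mul.
case: (boolP (t.1 && s.1)) => [|/negbTE h]; last first.
  apply: diamond_incl; case: t s h => -[] [a m i l] [[] g] //= _.
  - by right.
  - by left.
  - by left.
case: t s => -[] f [[] g] //= _.
rewrite -[tree_mul _ _]tree_beta_S /diamond diamond_withE -/(jct _ _).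
rewrite [tree_last _]/= [tree_first _]/= jctE /tree_beta !lin_ext_lin.
by apply: eq_lin_ext => r; rewrite /= !lin_ext_basis.
Qed.

Definition jct2 : freemod k ctree -> freemod k ctree -> freemod k ctree :=
  bilin_ext jct.

Lemma jct2E a b : jct2 (basis k a) (basis k b) = jct a b.
Proof. exact: bilin_ext_basis. Qed.

Lemma jct2_linl v : linear (jct2^~ v).
Proof. exact: bilin_ext_linl. Qed.

Lemma jct2_linr u : linear (jct2 u).
Proof. exact: bilin_ext_linr. Qed.

Lemma jct2N X : jct2 (basis k None) X = X.
Proof.
move: X; apply: linear_basis_ext => [|//|a].
  exact: jct2_linr.
by rewrite jct2E jctN.
Qed.

Lemma jct2N' X : jct2 X (basis k None) = X.
Proof.
move: X; apply: linear_basis_ext => [|//|a].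
  exact: jct2_linl.
by rewrite jct2E jctN'.
Qed.

Lemma angle_addA : associative angle_add.
Proof. by move=> i j l; apply/val_inj; rewrite /= addnA. Qed.

Lemma push_expand_leaf p x m i j :
  foldl pnode_push p (expand x m (angle_add i j)) =
  pnode_push (foldl pnode_push p (expand x m i)) (None, j).
Proof.
elim/last_ind: m i => [|m r _] i.
  case: p => [[[a n] l]|//].
  by case: x => [//|] /=; rewrite angle_addA.
rewrite !expand_rcons !foldl_rcons.
by have [[[a n] l] ->] := push_neq0 p x m r.1.
Qed.

Lemma push_reexpand a m i L : exists m' i',
  foldl pnode_push (Some (a, m, i)) L = Some (a, m', i') /\
  forall p x, foldl pnode_push p (expand x m' i') =
    foldl pnode_push (foldl pnode_push p (expand x m i)) L.
Proof.
elim: L m i => [|[[f|] j] L IH] m i; first by exists m, i.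
  have [m' [i' [E1 E2]]] := IH (rcons m (i, f)) j.
  exists m', i'; split=> [|p x]; first exact: E1.
  by rewrite E2 expand_rcons foldl_rcons.
have [m' [i' [E1 E2]]] := IH m (angle_add i j).
exists m', i'; split=> [|p x]; first exact: E1.
by rewrite E2 push_expand_leaf.
Qed.

Lemma finish_node a m i z r : exists m' i' l',
  finish (Some (a, m, i)) z r = Some (false, INode a m' i' l') /\
  forall p x, finish p x (false, INode a m' i' l') =
    finish (foldl pnode_push p (expand x m i)) z r.
Proof.
case: r => -[g|[b n j l]] /=; first by exists m, i, z.
have [m' [i' [E1 E2]]] := push_reexpand a m i (expand z n j).
by exists m', i', l; split=> [|p x]; rewrite ?E1 // E2.
Qed.

Lemma jct_someL f b : exists g, jct (Some f) b = lin_ext (fun f => basis k (Some f)) g.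
Proof.
case: b => [g|]; last by exists (basis k f); rewrite jctN' lin_ext_basis.
exists (lin_ext (fun t => basis k t.2) (nstar f g)); rewrite jctE lin_ext_lin.
by apply: eq_lin_ext => x; rewrite /= lin_ext_basis.
Qed.

Lemma jct_someR a g : exists h, jct a (Some g) = lin_ext (fun f => basis k (Some f)) h.
Proof.
case: a => [f|]; first exact: jct_someL.
by exists (basis k g); rewrite jctN lin_ext_basis.
Qed.

(* Associativity of tree_mul on t, s, r reduces to that of the junction when s
   has root label 1. *)
Lemma tree_mulA_basis (t s r : dtree) :
  (s.1 -> jct2 (jct (tree_last t) (Some s.2)) (basis k (tree_first r)) =
          jct2 (basis k (tree_last t)) (jct (Some s.2) (tree_first r))) ->
  tree_mul (basis k t) (tree_mul (basis k s) (basis k r)) =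
  tree_mul (tree_mul (basis k t) (basis k s)) (basis k r).
Proof.
move=> jA; rewrite (tree_mulE s r) (tree_mulE t s).
rewrite (lin_ext_comp _ _ (tree_mul_linr (basis k t))).
rewrite [RHS](lin_ext_comp _ _ (tree_mul_linl (basis k r))).
case: s jA => -[] s; last first.
  case: s => a m i l _.
  pose F x z := fins (foldl pnode_push (tree_lc t) (expand x m i)) z r.
  have -> : tree_mul (basis k t) \o
      (fun z => fins (tree_lc (false, INode a m i l)) z r) =
      fun z => lin_ext (F^~ z) (jct (tree_last t) a).
    apply/funext => z /=; rewrite /F /fins.
    have [m' [i' [l' [-> E]]]] := finish_node a m i z r.
    by rewrite tree_mulE; apply: eq_lin_ext => x; rewrite /fins E.
  rewrite lin_ext_swap; apply: eq_lin_ext => x /=.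
  rewrite /F /fins /=.
  have [[[b n] j] E] := push_neq0 (tree_lc t) x m i.
  by rewrite E tree_mulE.
move=> /(_ isT) /= jA.
pose F z := fins (tree_lc t) z r.
have -> : lin_ext (tree_mul (basis k t) \o fun z => fins None z r)
    (jct (Some s) (tree_first r)) =
    lin_ext F (jct2 (basis k (tree_last t)) (jct (Some s) (tree_first r))).
  have [g ->] := jct_someL s (tree_first r).
  rewrite (lin_ext_comp _ _ (jct2_linr _)) !lin_ext_lin.
  apply: eq_lin_ext => f /=; rewrite lin_ext_basis jct2E /F /fins.
  case: r {jA F} => -[h|[b n j l]] /=; first by rewrite tree_mulE.
  by rewrite [foldl _ _ _]push_expand /= tree_mulE.
rewrite -jA; have [g ->] := jct_someR (tree_last t) s.
rewrite (lin_ext_comp _ _ (jct2_linl _)) !lin_ext_lin.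
apply: eq_lin_ext => f /=; rewrite lin_ext_basis jct2E /F /fins /=.
by case: (t) => -[f'|[b n j l]] /=; rewrite tree_mulE.
Qed.

Lemma linD (V W : lmodType k) (f : V -> W) : linear f -> {morph f : x y / x + y}.
Proof. by move=> fl x y; rewrite -[x]scale1r fl !scale1r. Qed.

Lemma linB (V W : lmodType k) (f : V -> W) : linear f -> {morph f : x y / x - y}.
Proof. by move=> fl x y; rewrite addrC -scaleN1r fl scaleN1r addrC. Qed.

Definition tree_star (X Y : freemod k dtree) : freemod k dtree :=
  tree_mul (tree_beta X) Y + tree_mul X (tree_beta Y) - tree_mul X Y.

Lemma lin_comb (V W : lmodType k) (f1 f2 f3 : V -> W) :
  linear f1 -> linear f2 -> linear f3 -> linear (fun x => f1 x + f2 x - f3 x).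
Proof.
move=> l1 l2 l3 c x y; rewrite l1 l2 l3 scalerBr scalerDr opprD.
by rewrite (addrACA (c *: f1 x)) [LHS]addrACA.
Qed.

Lemma tree_star_linl Y : linear (tree_star^~ Y).
Proof.
apply: (lin_comb (f1 := fun X => tree_mul (tree_beta X) Y)
  (f2 := fun X => tree_mul X (tree_beta Y)) (f3 := fun X => tree_mul X Y)).
- by move=> c x y; rewrite tree_beta_lin tree_mul_linl.
- exact: tree_mul_linl.
- exact: tree_mul_linl.
Qed.

Lemma tree_star_linr X : linear (tree_star X).
Proof.
apply: (lin_comb (f1 := fun Y => tree_mul (tree_beta X) Y)
  (f2 := fun Y => tree_mul X (tree_beta Y)) (f3 := fun Y => tree_mul X Y)).
- exact: tree_mul_linr.
- by move=> c x y; rewrite tree_beta_lin tree_mul_linr.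
- exact: tree_mul_linr.
Qed.

Lemma tree_betaE b f : tree_beta (rooted b f) = rooted true f.
Proof. exact: lin_ext_basis. Qed.

Lemma tree_unE b f : tree_un (rooted b f) = rooted false f.
Proof. exact: lin_ext_basis. Qed.

Lemma nstarE f g : nstar f g = tree_star (rooted false f) (rooted false g).
Proof. by rewrite /tree_star !tree_betaE. Qed.

Lemma jct2_below X Y : jct2 (lin_ext below X) (lin_ext below Y) =
  lin_ext below (tree_star (tree_un X) (tree_un Y)).
Proof.
move: X; apply: linear_basis_ext => [c x y|c x y|[b f]].
- by rewrite lin_ext_is_linear jct2_linl.
- by rewrite linearP tree_star_linl lin_ext_is_linear.
move: Y; apply: linear_basis_ext => [c x y|c x y|[c g]].
- by rewrite lin_ext_is_linear jct2_linr.
- by rewrite linearP tree_star_linr lin_ext_is_linear.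
by rewrite !lin_ext_basis jct2E jctE nstarE -!/(rooted _ _) !tree_unE.
Qed.

Lemma tree_star_nstar X f g : tree_star X (nstar f g) =
  tree_mul (tree_beta X) (nstar f g)
  + tree_mul X (tree_mul (rooted true f) (rooted true g)) - tree_mul X (nstar f g).
Proof. by rewrite /tree_star tree_beta_S. Qed.

Lemma nstar_star Y f g : tree_star (nstar f g) Y =
  tree_mul (tree_mul (rooted true f) (rooted true g)) Y
  + tree_mul (nstar f g) (tree_beta Y) - tree_mul (nstar f g) Y.
Proof. by rewrite /tree_star tree_beta_S. Qed.

Lemma tree_star_assoc f g h :
  (forall a b c, ~~ [&& a, b & c] ->
    tree_mul (rooted a f) (tree_mul (rooted b g) (rooted c h)) =
    tree_mul (tree_mul (rooted a f) (rooted b g)) (rooted c h)) ->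
  tree_star (rooted false f) (nstar g h) = tree_star (nstar f g) (rooted false h).
Proof.
move=> A; rewrite tree_star_nstar nstar_star !tree_betaE /nstar.
rewrite !(linB (tree_mul_linr _)) !(linD (tree_mul_linr _)).
rewrite !(linB (tree_mul_linl _)) !(linD (tree_mul_linl _)) !A //.
move: (tree_mul (tree_mul (rooted true f) (rooted true g)) (rooted false h)) => x1.
move: (tree_mul (tree_mul (rooted true f) (rooted false g)) (rooted true h)) => x2.
move: (tree_mul (tree_mul (rooted true f) (rooted false g)) (rooted false h)) => x3.
move: (tree_mul (tree_mul (rooted false f) (rooted true g)) (rooted true h)) => x4.
move: (tree_mul (tree_mul (rooted false f) (rooted true g)) (rooted false h)) => x5.
move: (tree_mul (tree_mul (rooted false f) (rooted false g)) (rooted true h)) => x6.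
move: (tree_mul (tree_mul (rooted false f) (rooted false g)) (rooted false h)) => x7.
by rewrite !opprD !opprK !addrA [LHS](ACl (1*2*4*6*3*5*7)).
Qed.

Lemma jct_assoc a b c :
  jct2 (jct a b) (basis k c) = jct2 (basis k a) (jct b c).
Proof.
case: a b c => [f|] [g|] [h|]; rewrite ?(jctN, jctN', jct2N, jct2N', jct2E) //.
move: {2}(_ + _)%N (leqnn (rdepth f + ldepth h)) => n.
elim: n f g h => [|n IH] f g h.
  by case: f => a m i l; rewrite leqNgt.
move=> lefh.
have -> : basis k (Some h) = lin_ext below (rooted false h) by rewrite lin_ext_basis.
have -> : basis k (Some f) = lin_ext below (rooted false f) by rewrite lin_ext_basis.
rewrite !jctE !jct2_below !tree_un_S !tree_unE tree_star_assoc // => a b c abc.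
apply: tree_mulA_basis => /= bT; rewrite {}bT {b} in abc *.
have {}IH f' h' : (hrdepth (ctree_bar f') + hldepth (ctree_bar h') <= n)%N ->
    jct2 (jct f' (Some g)) (basis k h') = jct2 (basis k f') (jct (Some g) h').
  by case: f' h' => [f'|] [h'|]; rewrite ?(jctN, jctN', jct2N, jct2N', jct2E) //; exact: IH.
apply: IH; rewrite -ltnS; apply: leq_trans lefh.
have [l1 l2] := tree_last_depth a f; have [r1 r2] := tree_first_depth c h.
case: a l1 l2 abc => l1 l2 abc; last by rewrite -addSn leq_add.
by case: c r1 r2 abc => // _ r2 _; rewrite -addnS leq_add.
Qed.

Lemma tree_mulA : associative tree_mul.
Proof.
move=> u v w; move: u.
apply: linear_basis_ext => [c x y|c x y|u]; rewrite ?tree_mul_linl //.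
move: v; apply: linear_basis_ext => [c x y|c x y|v].
- by rewrite tree_mul_linl tree_mul_linr.
- by rewrite tree_mul_linr tree_mul_linl.
move: w; apply: linear_basis_ext => [c x y|c x y|w].
- by rewrite !tree_mul_linr.
- by rewrite tree_mul_linr.
by apply: tree_mulA_basis => _; exact: jct_assoc.
Qed.

Lemma tree_betaK_mul f g : tree_beta (tree_mul (rooted true f) (rooted true g)) =
  tree_mul (rooted true f) (rooted true g).
Proof.
rewrite -tree_beta_S /tree_beta lin_ext_lin.
by apply: eq_lin_ext => t; rewrite lin_ext_basis.
Qed.

Lemma tree_beta_baxter u v : tree_mul (tree_beta u) (tree_beta v) =
  tree_beta (tree_mul (tree_beta u) v + tree_mul u (tree_beta v)
    + -1 *: tree_mul u v).
Proof.
rewrite scaleN1r -/(tree_star u v).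
move: u; apply: linear_basis_ext => [c x y|c x y|[b f]].
- by rewrite tree_beta_lin tree_mul_linl.
- by rewrite tree_star_linl tree_beta_lin.
move: v; apply: linear_basis_ext => [c x y|c x y|[c g]].
- by rewrite tree_beta_lin tree_mul_linr.
- by rewrite tree_star_linr tree_beta_lin.
rewrite -!/(rooted _ _) !tree_betaE /tree_star !tree_betaE.
case: b; first by rewrite addrC addKr tree_betaK_mul.
case: c; first by rewrite addrK tree_betaK_mul.
by rewrite -/(nstar f g) tree_beta_S.
Qed.
End TreeProducts.

Definition Btree (k : comPzRingType) : Type := freemod k dtree.

Section Btree.
Context (k : comPzRingType).
HB.instance Definition _ := GRing.Lmodule.on (Btree k).
HB.instance Definition _ := isBaxterAlgebra.Build k (-1) (Btree k)
  (@tree_mul_linl k) (@tree_mul_linr k) (@tree_mulA k) (@tree_beta_lin k)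
  (@tree_beta_baxter k).
End Btree.

Definition lin_span (k : comPzRingType) (V : lmodType k) (X : V -> Prop)
    (v : V) : Prop :=
  exists n (c : 'I_n -> k) (u : 'I_n -> V),
    (forall i, X (u i)) /\ v = \sum_i c i *: u i.

Definition sim_ideal (k : comPzRingType) : Btree k -> Prop :=
  lin_span (fun v : Btree k =>
    exists t s, tree_sim t s /\ v = basis k t - basis k s).

(* Main.v *)
Require Import Defs.
From HB Require Import structures.
From mathcomp Require Import all_boot all_algebra.
From mathcomp Require Import finmap.
From mathcomp.classical Require Import boolp.
From mathcomp.multinomials Require Import monalg.
Set Implicit Arguments.
Unset Strict Implicit.
Unset Printing Implicit Defensive.
Import GRing.Theory.
Local Open Scope ring_scope.

(** The isomorphism is induced by a Baxter morphism
    $\Phi : B^{-1}_{\infty,2} \to M_\infty$ that sends each tree to a single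
    word, recorded run by run: a tree with root label 1 goes to $x_1^{\deg t}$,
    and a tree with root label 0, with root subtrees $t_1, ..., t_n$ and root angles
    $i_1, ..., i_{n-1}$, goes to
    $x_1^{\deg t_1} x_0^{i_1} x_1^{\deg t_2} ... x_0^{i_{n-1}} x_1^{\deg t_n}$.

    Compatibility with the operators is clear, since relabelling the root by 1
    turns all letters into $x_1$.  For products, grafting concatenates runs:
    dropping an inner leaf and merging its two angles is
    $x_0^i x_1^0 x_0^j = x_0^{i+j}$ ([finish_word]).  The remaining point is the
    junction $\beta(\bar t_n * \bar s_1)$, a combination of many trees: all of
    them have degree $\deg t_n + \deg s_1$ and their coefficients add up to
    $1 + 1 - 1 = 1$, so that $\Phi$ only sees $x_1^{\deg t_n + \deg s_1}$
    ([jct_deg]).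

    Only the first and the last run of $x_1$ can be empty, as the inner
    subtrees are not leaves; hence the word determines all the run lengths, and
    $t \sim s$ holds exactly when $t$ and $s$ have the same word
    ([tree_simP]).  The kernel of the linear extension of a map of bases is
    spanned by the differences of basis elements with the same image
    ([ker_lin_ext_basis]), so the kernel of $\Phi$ is $I$.  Since $x_0$ and
    $x_1$ are words of trees, $\Phi$ is surjective, and the first isomorphism
    theorem concludes. *)

(** * The first isomorphism theorem for Baxter algebras *)

Section FirstIsomorphism.
Context (k : comPzRingType) (lam : k) (A B : baxterAlgType lam).
Context (f : {linear A -> B}) (I : A -> Prop).
Context (fM : {morph f : x y / bmul x y}) (fop : {morph f : x / bop x}).
Context (kerf : forall x, I x <-> f x = 0).

Lemma kernel_baxter_ideal : baxter_ideal I.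
Proof.
have bmul0l (x : B) : bmul 0 x = 0 by rewrite -[X in bmul X _](subrr 0) bmulBl subrr.
have bmul0r (x : B) : bmul x 0 = 0 by rewrite -[X in bmul _ X](subrr 0) bmulBr subrr.
have bop0 : bop (0 : B) = 0 by rewrite -[X in bop X](subrr 0) bopB subrr.
split=> [|c x y /kerf fx /kerf fy|a x /kerf fx|a x /kerf fx|x /kerf fx]; apply/kerf.
- exact: linear0.
- by rewrite linearP fx fy scaler0 addr0.
- by rewrite fM fx bmul0r.
- by rewrite fM fx bmul0l.
- by rewrite fop fx bop0.
Qed.

Lemma first_isomorphism : (forall y, exists x, f x = y) ->
  exists hI : baxter_ideal I, baxter_isomorphic B (baxter_quot hI).
Proof.
move=> f_onto; exists kernel_baxter_ideal; set hI := kernel_baxter_ideal.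
pose s y := projT1 (cid (f_onto y)).
have fs y : f (s y) = y by rewrite /s; case: cid.
have pE x y : f x = f y -> bproj hI x = bproj hI y.
  by move=> e; apply/bproj_eq/kerf; rewrite linearB e subrr.
pose g y := bproj hI (s y).
have g_lin : linear g.
  by move=> c x y; rewrite -bproj_is_linear; apply: pE; rewrite linearP !fs.
pose G : {linear B -> baxter_quot hI} :=
  HB.pack g (GRing.isLinear.Build k _ _ *:%R g g_lin).
exists G; split=> [|x y|x] /=.
- exists (fun q => f (brepr q)) => [y|q] /=.
    have /kerf/eqP := brepr_proj hI (s y).
    by rewrite linearB subr_eq0 fs => /eqP.
  by rewrite -[RHS]breprK; apply: pE; rewrite fs.
- rewrite /g -[RHS]/(bq_mul _ _) bproj_mul; apply: pE.
  by rewrite fM !fs.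
- by rewrite /g -[RHS]/(bq_op _) bproj_op; apply: pE; rewrite fop !fs.
Qed.
End FirstIsomorphism.

(** Modulo the span, each basis element in [v] may be replaced by a chosen one
    with the same image under [f]; the sum so obtained depends only on the image
    of [v] under the linear extension of [f], and vanishes with it. *)
Lemma ker_lin_ext_basis (k : comPzRingType) (K L : choiceType) (f : K -> L)
    (v : freemod k K) :
  lin_ext (fun x => basis k (f x)) v = 0 ->
  lin_span (fun w => exists x y, f x = f y /\ w = basis k x - basis k y) v.
Proof.
move=> fv0.
pose s y : freemod k K :=
  if pselect (exists x, f x = y) is left e then basis k (projT1 (cid e)) else 0.
have sP x : exists y, f y = f x /\ s (f x) = basis k y.
  rewrite /s; case: pselect => [e|[]]; last by exists x.
  by exists (projT1 (cid e)); split=> //; case: cid.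
have vE : v = \sum_(x <- msupp v) v@_x *: (basis k x - s (f x)).
  have sv0 : \sum_(x <- msupp v) v@_x *: s (f x) = 0.
    have : lin_ext s (lin_ext (fun x => basis k (f x)) v) = 0.
      by rewrite fv0 linear0.
    rewrite lin_ext_lin (lin_extEw _ (fsubset_refl _)) => e; rewrite -[RHS]e.
    by apply: eq_bigr => x _; rewrite lin_ext_basis.
  rewrite (eq_bigr (fun x => v@_x *: basis k x - v@_x *: s (f x))); last first.
    by move=> x _; rewrite scalerBr.
  by rewrite sumrB sv0 subr0 -freemodE.
pose r := in_tuple (msupp v).
exists (size (msupp v)), (fun i => v@_(tnth r i)),
  (fun i => basis k (tnth r i) - s (f (tnth r i))).
split=> [i|]; last by rewrite [LHS]vE big_tnth.
by have [y [fy ->]] := sP (tnth r i); exists (tnth r i), y.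
Qed.

(** * The word of a tree *)

Section TreeWord.
Implicit Types (c : ctree) (t s : dtree) (p : pnode) (m : seq (angle * inode)).

Definition x1_run c : seq bool := nseq (angle_deg_ctree c) true.

Definition inner_runs m : seq bool :=
  flatten [seq nseq (val q.1) false ++ nseq (angle_deg_inode q.2) true | q <- m].

Definition pnode_word p : seq bool :=
  if p is Some (a, m, i) then x1_run a ++ inner_runs m ++ nseq (val i) false
  else [::].

(** The split into all but the last child and the last child is the one along
    which a product joins its left factor; it also makes a tree with root label
    1 its own last child, hence a pure power of $x_1$. *)
Definition tree_word t : seq bool :=
  pnode_word (tree_lc t) ++ x1_run (tree_last t).

(** What remains of [tree_word t] after the run of its first child, along
    which a product joins its right factor. *)
Definition tree_word_tail t : seq bool :=
  if t is (false, INode _ m i l)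
  then inner_runs m ++ nseq (val i) false ++ x1_run l else [::].

Lemma tree_word_first t : tree_word t = x1_run (tree_first t) ++ tree_word_tail t.
Proof. by case: t => -[f|[a m i l]]; rewrite /tree_word /= ?cats0 // -!catA. Qed.

Lemma inner_runs_cons q m : inner_runs (q :: m) =
  nseq (val q.1) false ++ nseq (angle_deg_inode q.2) true ++ inner_runs m.
Proof. by rewrite catA. Qed.

Lemma inner_runs_rcons m q : inner_runs (rcons m q) =
  inner_runs m ++ nseq (val q.1) false ++ nseq (angle_deg_inode q.2) true.
Proof. by rewrite /inner_runs map_rcons flatten_rcons. Qed.

Lemma pnode_push_word p c j :
  pnode_word (pnode_push p (c, j)) = pnode_word p ++ x1_run c ++ nseq (val j) false.
Proof.
case: p c => [[[a m] i]|] [f|] //=; first by rewrite inner_runs_rcons -!catA.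
by rewrite nseqD -!catA.
Qed.

Lemma foldl_push_word p c m i :
  pnode_word (foldl pnode_push p (expand c m i)) =
  pnode_word p ++ x1_run c ++ inner_runs m ++ nseq (val i) false.
Proof.
elim/last_ind: m i => [|m q IH] i; first by rewrite /expand /= pnode_push_word.
by rewrite expand_rcons foldl_rcons pnode_push_word IH inner_runs_rcons -!catA.
Qed.

Lemma finish_word p c s r : finish p c s = Some r ->
  tree_word r = pnode_word p ++ x1_run c ++ tree_word_tail s.
Proof.
have closeE q l u : pnode_close q l = Some u ->
    tree_word u = pnode_word q ++ x1_run l.
  by case: q => [[[a m] i]|] /=; [case=> <-|case: l => [f|//] [<-]].
case: s => -[g|[b n j l]] /= /closeE ->; first by rewrite cats0.
by rewrite foldl_push_word -!catA.
Qed.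

Lemma size_tree_word t : size (tree_word t) = angle_deg t.
Proof.
case: t => -[f|[a m i l]]; first by rewrite /tree_word size_nseq.
rewrite /tree_word /angle_deg /= !size_cat !size_nseq addnA /inner_runs.
rewrite size_flatten /shape -map_comp.
congr (_ + _ + _ + _)%N; congr sumn; apply: eq_map => q /=.
by rewrite size_cat !size_nseq.
Qed.

Lemma angle_deg_gt0 f : (0 < angle_deg_inode f)%N.
Proof. by case: f => a m i l /=; rewrite !addn_gt0 (valP i) !orbT. Qed.

Lemma tree_word_neq0 t : tree_word t != [::].
Proof. by rewrite -size_eq0 size_tree_word -lt0n angle_deg_gt0. Qed.

Definition word_of t : word := exist (fun w => w != [::]) _ (tree_word_neq0 t).

(** * Trees with the same word *)

Lemma nseq_cat_inj (b : bool) d e u v :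
  ohead u != Some b -> ohead v != Some b ->
  nseq d b ++ u = nseq e b ++ v -> d = e /\ u = v.
Proof.
move=> hu hv; elim: d e => [|d IH] [|e] //=.
- by move=> uE; rewrite uE eqxx in hu.
- by move=> vE; rewrite -vE eqxx in hv.
- by case=> /IH [-> ->].
Qed.

Lemma ohead_nseq_cat (b : bool) n u : (0 < n)%N -> ohead (nseq n b ++ u) = Some b.
Proof. by case: n. Qed.

Lemma ohead_inner_runs m (i : angle) u :
  ohead (inner_runs m ++ nseq (val i) false ++ u) = Some false.
Proof.
case: m => [|q m]; first by rewrite ohead_nseq_cat ?(valP i).
by rewrite inner_runs_cons -!catA ohead_nseq_cat ?(valP q.1).
Qed.

Lemma ohead_x1_run c : ohead (x1_run c) != Some false.
Proof. by rewrite /x1_run; case: (angle_deg_ctree c). Qed.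

(** A run of $x_1$ between two inner angles is nonempty, so each run of $x_0$
    is exactly one angle. *)
Lemma inner_runs_inj m n (i j : angle) l r :
  inner_runs m ++ nseq (val i) false ++ x1_run l =
  inner_runs n ++ nseq (val j) false ++ x1_run r ->
  [/\ [seq (q.1, angle_deg_inode q.2) | q <- m] =
      [seq (q.1, angle_deg_inode q.2) | q <- n],
      i = j & angle_deg_ctree l = angle_deg_ctree r].
Proof.
elim: m n => [|q m IH] [|q' n].
- case/nseq_cat_inj; rewrite ?ohead_x1_run // => /val_inj ->.
  by move=> /(congr1 size); rewrite !size_nseq => ->.
- rewrite inner_runs_cons -!catA.
  case/nseq_cat_inj; rewrite ?ohead_x1_run ?ohead_nseq_cat ?angle_deg_gt0 //.
  move=> _; rewrite -[x1_run l]cats0.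
  case/nseq_cat_inj; rewrite ?ohead_inner_runs // => _ /(congr1 ohead).
  by rewrite ohead_inner_runs.
- rewrite inner_runs_cons -!catA.
  case/nseq_cat_inj; rewrite ?ohead_x1_run ?ohead_nseq_cat ?angle_deg_gt0 //.
  move=> _; rewrite -[x1_run r]cats0.
  case/nseq_cat_inj; rewrite ?ohead_inner_runs // => _ /(congr1 ohead).
  by rewrite ohead_inner_runs.
rewrite !inner_runs_cons -!catA.
case/nseq_cat_inj; rewrite ?ohead_nseq_cat ?angle_deg_gt0 // => /val_inj q1E.
case/nseq_cat_inj; rewrite ?ohead_inner_runs // => q2E /IH [mE -> ->].
by rewrite /= q1E q2E mE.
Qed.

Lemma tree_wordP t s : tree_word t = tree_word s <-> tree_sim t s.
Proof.
(* The letter x_0 tells the two root labels apart. *)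
have root_neq f a m i l : tree_word (true, f) <> tree_word (false, INode a m i l).
  rewrite [RHS]tree_word_first /tree_word /= -[x1_run (Some f)]cats0.
  case/nseq_cat_inj; rewrite ?ohead_inner_runs // => _ /(congr1 ohead).
  by rewrite ohead_inner_runs.
split.
  case: t s => -[f|[a m i l]] [[g|[b n j r]]].
  - by move=> /(congr1 size); rewrite !size_tree_word.
  - by move/root_neq.
  - by move/esym/root_neq.
  rewrite !tree_word_first /=.
  case/nseq_cat_inj; rewrite ?ohead_inner_runs // => abE.
  case/inner_runs_inj => mnE -> lrE; split=> //=.
  rewrite !size_rcons !size_map !map_rcons -!map_comp abE lrE.
  have /(congr1 size) := mnE; rewrite !size_map => ->.
  have /(congr1 (map fst)) := mnE; rewrite -!map_comp.
  have /(congr1 (map snd)) := mnE; rewrite -!map_comp.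
  by move=> e2 e1; split; rewrite ?size_map //; [congr (_ :: rcons _ _)|congr rcons].
case: t s => -[f|[a m i l]] [[g|[b n j r]]] [] //= _.
  by rewrite /tree_word /x1_run /= /angle_deg /= => ->.
rewrite !map_rcons -!map_comp.
case=> _ [abE] /rcons_inj [mnE lrE] /rcons_inj [mn1E ijE].
rewrite /tree_word /= /x1_run abE lrE ijE; congr ((_ ++ _ ++ _) ++ _).
elim: m n mnE mn1E => [|q m IH] [|q' n] //= [e2 E2] [e1 E1].
by rewrite !inner_runs_cons e1 e2 (IH n).
Qed.

Lemma tree_simP t s : tree_sim t s <-> word_of t = word_of s.
Proof.
rewrite -tree_wordP; split=> [e|/(congr1 val)//].
exact/val_inj.
Qed.
End TreeWord.

(** * Multiplicativity *)

Section TreeMorphism.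
Context (k : comPzRingType).
Implicit Types (t s : dtree) (a b : ctree).

(** All trees of the combination [jct a b] have the degree of [a] plus that of
    [b], and their coefficients have sum 1: testing against all functions of
    the degree says both at once. *)
Definition deg_additive a b := forall (V : lmodType k) (h : nat -> V),
  lin_ext (fun c => h (angle_deg_ctree c)) (jct k a b) =
  h (angle_deg_ctree a + angle_deg_ctree b)%N.

Lemma tree_mul_word_of_jct (V : lmodType k) (h : seq bool -> V) t s :
  t.1 && s.1 = false -> deg_additive (tree_last t) (tree_first s) ->
  lin_ext (fun r => h (tree_word r)) (tree_mul (basis k t) (basis k s)) =
  h (tree_word t ++ tree_word s).
Proof.
move=> ts jD; rewrite tree_mulE lin_ext_lin.
pose h' n := h (pnode_word (tree_lc t) ++ nseq n true ++ tree_word_tail s).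
rewrite (eq_lin_ext (f2 := fun c => h' (angle_deg_ctree c))) => [|c].
  by rewrite jD /h' nseqD (tree_word_first s) -!catA.
have tsN : tree_lc t <> None \/ s.1 = false.
  by case: t s ts {jD h'} => -[f|[a m i l]] [[] g] //= _; [right|left|left].
rewrite /fins; have [r rE _] := finish_some c tsN.
by rewrite rE /= lin_ext_basis (finish_word rE).
Qed.

(** The recursion behind the products: each of the three products that make up
    the junction of [f] and [g] has a junction of smaller depth, and by
    induction the total coefficient is $1 + 1 - 1$. *)
Lemma jct_deg a b : deg_additive a b.
Proof.
case: a b => [f|] [g|] V h; rewrite ?(jctN, jctN') ?lin_ext_basis ?addn0 //.
move: {2}(_ + _)%N (leqnn (rdepth f + ldepth g)) => n.
elim: n f g V h => [|n IH] f g V h; first by case: f => a m i l; rewrite leqNgt.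
move=> lefg.
have mulE (b c : bool) : b && c = false ->
    lin_ext (fun t : dtree => h (angle_deg_inode t.2))
      (tree_mul (rooted k b f) (rooted k c g)) =
    h (angle_deg_inode f + angle_deg_inode g)%N.
  move=> bc; have := @tree_mul_word_of_jct V (h \o size) (b, f) (c, g) bc.
  rewrite (eq_lin_ext (f2 := fun t => h (angle_deg_inode t.2))) => [|t]; last first.
    by rewrite /= size_tree_word.
  move=> ->; first by rewrite /= size_cat !size_tree_word.
  have : (hrdepth (ctree_bar (tree_last (b, f))) +
          hldepth (ctree_bar (tree_first (c, g))) <= n)%N.
    rewrite -ltnS; apply: leq_trans lefg.
    have [l1 l2] := tree_last_depth b f; have [r1 r2] := tree_first_depth c g.
    case: b l1 l2 bc => l1 l2 bc; last by rewrite -addSn leq_add.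
    by case: c r1 r2 bc => // _ r2 _; rewrite -addnS leq_add.
  case: (tree_last _) (tree_first _) => [f'|] [g'|] le W h'; first exact: IH.
  - by rewrite jctN' lin_ext_basis addn0.
  - by rewrite jctN lin_ext_basis.
  - by rewrite jctN lin_ext_basis.
rewrite jctE lin_ext_lin.
rewrite (eq_lin_ext (f2 := fun t : dtree => h (angle_deg_inode t.2))) => [|t].
  by rewrite /nstar linearB linearD /= !mulE //= addrK.
by rewrite lin_ext_basis.
Qed.

Lemma tree_mul_word (V : lmodType k) (h : seq bool -> V) t s :
  lin_ext (fun r => h (tree_word r)) (tree_mul (basis k t) (basis k s)) =
  h (tree_word t ++ tree_word s).
Proof.
case: (boolP (t.1 && s.1)) => [|/negbTE ts]; last first.
  by apply: tree_mul_word_of_jct (jct_deg _ _).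
(* Two root labels 1: the product is a single junction, and both words are
   powers of x_1. *)
case: t s => -[] f [[] g] //= _.
have := jct_deg (Some f) (Some g) (fun n => h (nseq n true)).
rewrite /= nseqD => <-.
rewrite -tree_beta_S jctE /tree_beta !lin_ext_lin; apply: eq_lin_ext => r.
by rewrite !lin_ext_basis.
Qed.

Definition word_map : Btree k -> Minf k := lin_ext (fun t => basis k (word_of t)).
HB.instance Definition _ := GRing.isLinear.Build k (Btree k) (Minf k) *:%R
  word_map (lin_ext_is_linear _).

Lemma word_map_basis t : word_map (basis k t) = basis k (word_of t).
Proof. exact: lin_ext_basis. Qed.

Lemma word_mapM : {morph word_map : x y / tree_mul x y >-> Minf_mul x y}.
Proof.
move=> x y; move: x; apply: linear_basis_ext => [c u v|c u v|t].
- by rewrite tree_mul_linl linearP.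
- by rewrite linearP Minf_mul_linl.
move: y; apply: linear_basis_ext => [c u v|c u v|s].
- by rewrite tree_mul_linr linearP.
- by rewrite linearP Minf_mul_linr.
rewrite !word_map_basis Minf_mulE.
have := @tree_mul_word _ (fun w => basis k (insubd (letter true) w) : Minf k) t s.
rewrite (eq_lin_ext (f2 := fun r => basis k (word_of r))) => [|r]; last first.
  by congr basis; apply: val_inj; rewrite val_insubd tree_word_neq0.
move=> e; rewrite /word_map [LHS]e; congr basis; apply: val_inj.
by rewrite val_insubd (valP (word_cat (word_of t) (word_of s))).
Qed.

Lemma word_map_beta : {morph word_map : x / tree_beta x >-> Minf_beta x}.
Proof.
apply: linear_basis_ext => [c u v|c u v|t].
- by rewrite tree_beta_lin linearP.
- by rewrite linearP Minf_beta_lin.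
rewrite [tree_beta _]lin_ext_basis !word_map_basis Minf_betaE.
congr basis; apply: val_inj => /=.
have map_true (w : seq bool) : [seq true | _ <- w] = nseq (size w) true.
  by elim: w => //= b w ->.
by rewrite map_true size_tree_word.
Qed.

(** The image is closed under products, and the letters $x_0$ and $x_1$ are the
    words of the one-angle tree with either root label. *)
Lemma word_map_onto y : exists x, word_map x = y.
Proof.
pose u0 : angle := exist (fun n => (0 < n)%N) 1%N isT.
have letter_onto (b : bool) : word_map (basis k (b, INode None [::] u0 None)) =
    basis k (letter b).
  by rewrite word_map_basis; congr basis; apply: val_inj; case: b.
have word_onto w : exists x, word_map x = basis k w.
  case: w => w; elim: w => [//|b [_|c w IH]] wN.
    exists (basis k (b, INode None [::] u0 None)).
    by rewrite letter_onto; congr basis; apply: val_inj.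
  have [x xE] := IH isT.
  exists (tree_mul (basis k (b, INode None [::] u0 None)) x).
  rewrite word_mapM letter_onto xE Minf_mulE; congr basis; exact: val_inj.
pose g w := projT1 (cid (word_onto w)).
exists (lin_ext g y); move: y; apply: linear_basis_ext => [c u v|//|w].
  by rewrite !linearP.
by rewrite lin_ext_basis /g; case: cid.
Qed.

Lemma sim_ideal_kernel x : sim_ideal x <-> word_map x = 0.
Proof.
split=> [[n [c [u [uP ->]]]]|/ker_lin_ext_basis [n [c [u [uP ->]]]]].
  rewrite linear_sum big1 // => i _; rewrite linearZ.
  have [t [s [/tree_simP ts ->]]] := uP i.
  by rewrite linearB /= !word_map_basis ts subrr scaler0.
exists n, c, u; split=> // i; have [t [s [/tree_simP ts ->]]] := uP i.
by exists t, s.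
Qed.
End TreeMorphism.

Theorem proposition4p3 (k : comPzRingType) :
  exists hI : baxter_ideal (@sim_ideal k : (Btree k : baxterAlgType (-1)) -> Prop),
    baxter_isomorphic (Minf k : baxterAlgType (-1)) (baxter_quot hI).
Proof.
pose f : {linear (Btree k : baxterAlgType (-1)) -> (Minf k : baxterAlgType (-1))} :=
  @word_map k.
apply: (@first_isomorphism _ _ _ _ f).
- exact: word_mapM.
- exact: word_map_beta.
- exact: sim_ideal_kernel.
- exact: word_map_onto.
Qed.
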